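(* Let $CG_n$ be the undirected, unweighted cycle-graph on $n\ge3$ vertices and $PG_m$ the undirected, unweighted path-graph on $m$ vertices. For $q>0$, $$Z_{CG_n}(q)=Z_{PG_n}(q)+\tfrac2q\left[Z_{PG_n}(q)-Z_{PG_{n-1}}(q)\right]-2=\sum_{k=1}^{n}\left(\binom{n+k}{2k}+\binom{n+k-1}{2k}\right)q^k.$$
   Context: Each undirected edge is considered as two directed edges (one per orientation) of weight $1$. A rooted spanning forest of a finite directed graph is a subset $F$ of its directed edges such that each vertex has at most one outgoing edge in $F$ and $F$ contains no directed cycle; its roots are the vertices without outgoing edge in $F$ and $r(F)$ is the number of roots. The partition function of a graph $G$ with all edge weights $1$ is $Z_G(q)=\sum_F q^{r(F)}$, the sum running over all rooted spanning forests of $G$; equivalently $Z_G(q)=\det[qI-L]$ with $L=A-D$, where $A$ is the adjacency matrix and $D$ the diagonal degree matrix. Binomial coefficients $\binom{a}{b}$ with $b>a\geq 0$ are $0$. *)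

(* Defs.v *)
From HB Require Import structures.
From mathcomp Require Import all_boot all_order all_algebra.

Set Implicit Arguments.
Unset Strict Implicit.
Unset Printing Implicit Defensive.

Import Order.TTheory GRing.Theory Num.Theory.
Local Open Scope ring_scope.

(* A finite directed graph is a relation [e : rel T] on a finite type; an
   undirected graph is a symmetric one, so that each undirected edge {x, y}
   gives the two directed edges (x, y) and (y, x). *)

Section Forests.

Variable T : finType.
Implicit Types (e : rel T) (F : {set T * T}).

Definition edges e : {set T * T} := [set p | e p.1 p.2].

Definition edge_in F : rel T := fun x y => (x, y) \in F.

(* A directed cycle visits pairwise distinct vertices, hence has at most #|T|
   of them. Loops and back-and-forth pairs x -> y -> x are directed cycles. *)
Definition has_dicycle F : bool :=
  [exists k : 'I_#|T|, exists c : k.+1.-tuple T, ucycleb (edge_in F) c].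

Lemma has_dicycleP F :
  reflect (exists2 c : seq T, c != [::] & ucycle (edge_in F) c)
          (has_dicycle F).
Proof.
apply: (iffP existsP) => [[k /existsP[c cF]]|[[|x s] // _ cF]].
  exists (tval c); last exact: cF.
  by rewrite -size_eq0 size_tuple.
have le_s : (size s < #|T|)%N.
  by case/andP: cF => _ /card_uniqP => /= <-; apply: max_card.
by exists (Ordinal le_s); apply/existsP; exists (in_tuple (x :: s)).
Qed.

Definition rooted_spanning_forest e F : bool :=
  [&& F \subset edges e,
      [forall x, #|[set y | (x, y) \in F]| <= 1]%N
    & ~~ has_dicycle F].

Definition roots F : {set T} := [set x | [forall y, (x, y) \notin F]].

Definition Z e (R : pzSemiRingType) (q : R) : R :=
  \sum_(F | rooted_spanning_forest e F) q ^+ #|roots F|.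

End Forests.

(* [ordS i] is i + 1 modulo n; for n >= 3 this is the simple n-cycle. *)
Definition cycle_graph (n : nat) : rel 'I_n :=
  fun i j => (j == ordS i) || (i == ordS j).

Definition path_graph (m : nat) : rel 'I_m :=
  fun i j => (j == i.+1 :> nat) || (i == j.+1 :> nat).

(* Main.v *)
Require Import Defs.
From HB Require Import structures.
From mathcomp Require Import all_boot all_order all_algebra.
From mathcomp Require Import zify ring.

Set Implicit Arguments.
Unset Strict Implicit.
Unset Printing Implicit Defensive.

Import Order.TTheory GRing.Theory Num.Theory.
Local Open Scope ring_scope.

(** The identities come from a transfer-matrix count of words.

    In a path or a cycle each vertex has at most one successor and at most one
    predecessor, so an edge set in which every vertex has at most one outgoing
    edge is a word: the letter at a vertex is [None] (a root), [Some true]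
    (go to the successor, abbreviated [fwd]) or [Some false] (go to the
    predecessor, [bwd]). The edge set has a directed cycle exactly when the
    factor fwd bwd occurs at some adjacent pair of vertices, or when the word
    runs around the whole graph in one direction. The latter is impossible in a
    path, and in a cycle it happens only for the two constant words fwd...fwd
    and bwd...bwd, whence the term -2 ([fits_acyclic_path],
    [fits_acyclic_cycle]).

    Let W_n(a, b), formally [walk_sum n a b], be the weighted number of words t
    of length n such that a t b has no factor fwd bwd, where the weight is q to
    the number of roots. A path word must not begin with bwd nor end with fwd,
    that is, fwd t bwd has no factor fwd bwd; so Z(PG_n) = W_n(fwd, bwd).
    Cutting a cyclic word at one vertex gives the trace
    Z(CG_(n+1)) + 2 = q W_n(None, None) + W_n(fwd, fwd) + W_n(bwd, bwd).
    Summing over the first letter gives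
      W_(n+1)(fwd, b) = q W_n(bwd, b) + W_n(fwd, b),
      W_(n+1)(bwd, b) = W_n(bwd, b) + W_(n+1)(fwd, b).
    With P_n = W_n(fwd, bwd) and X_n = W_n(bwd, bwd), these imply that the
    trace is P_(n+1) + 2 X_n ([cycle_sum]), while q X_n = P_(n+1) - P_n: this
    is the first identity. The same two recurrences are Pascal's rule for
      X_n = sum_k C(n+k, 2k) q^k,   P_n = sum_k C(n+k, 2k+1) q^(k+1)
    ([walk_sum_closed]), which gives the second identity. *)

(** * Rooted forests as words *)

Definition letter_ok (a b : option bool) : bool :=
  ~~ ((a == Some true) && (b == Some false)).

Section Words.

Variables (T : finType) (s : rel T).
Implicit Types (w : {ffun T -> option bool}) (b : bool) (F : {set T * T}).

(** The relation [s] plays the role of a partial successor function; the graph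
    of interest is its symmetric closure. *)
Definition step b : rel T := fun x y => if b then s x y else s y x.

Definition word_edges w : {set T * T} :=
  [set p | if w p.1 is Some b then step b p.1 p.2 else false].

Definition edge_word F : {ffun T -> option bool} :=
  [ffun x => if [exists y, ((x, y) \in F) && step true x y] then Some true
             else if [exists y, ((x, y) \in F) && step false x y]
                  then Some false else None].

(** Excludes a letter that points out of the graph, such as [Some true] at the
    end of a path: [word_edges] would silently turn such a letter into a root,
    and the word would not be recoverable from its edges. *)
Definition fits w : bool :=
  [forall x, if w x is Some b then [exists y, step b x y] else true].

Definition clash_free w : bool :=
  [forall x, forall y, s x y ==> letter_ok (w x) (w y)].

Lemma in_word_edges w x y :
  ((x, y) \in word_edges w) = (if w x is Some b then step b x y else false).
Proof. by rewrite inE. Qed.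

Hypothesis s_fun : forall x y z, s x y -> s x z -> y = z.
Hypothesis s_inj : forall x y z, s x z -> s y z -> x = y.
Hypothesis s_asym : forall x y, s x y -> ~~ s y x.

Lemma step_fun b x y z : step b x y -> step b x z -> y = z.
Proof. by case: b => /=; [apply: s_fun | apply: s_inj]. Qed.

(** Along a directed cycle, a forward step can only be succeeded by a
    forward step, as a backward one would clash. So either the cycle has a
    forward vertex, and then its forward vertices are closed under stepping,
    or all its vertices are backward. A closed monochromatic set is all that
    is recorded, because it suffices to conclude in both families of graphs. *)
Lemma word_edges_dicycle_mono w : clash_free w -> has_dicycle (word_edges w) ->
  exists b (A : {set T}), A != set0 /\
    forall x, x \in A -> w x = Some b /\ exists2 y, y \in A & step b x y.
Proof.
move=> /'forall_forallP no_clash /has_dicycleP[c c_neq0 /andP[cyc_c _]].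
have succ x : x \in c -> exists b, [/\ w x = Some b, next c x \in c
                                     & step b x (next c x)].
  move=> xc; have := next_cycle cyc_c xc; rewrite /edge_in in_word_edges.
  by case: (w x) => // b st; exists b; rewrite mem_next.
have [/hasP[x xc /eqP wx]|/hasPn no_fwd] := boolP (has (fun x => w x == Some true) c).
  exists true, [set z in c | w z == Some true]; split.
    by apply/set0Pn; exists x; rewrite inE xc wx eqxx.
  move=> z; rewrite inE => /andP[zc /eqP wz]; split=> //.
  have [b [wzb nzc st]] := succ z zc; move: wzb st; rewrite wz => -[<-] st.
  exists (next c z) => //; rewrite inE nzc.
  have [b' [wnz _ _]] := succ _ nzc.
  by have := no_clash z (next c z); rewrite wz wnz (st : s _ _) /=; case: b' wnz.
exists false, [set z in c]; split.
  by case: c c_neq0 {cyc_c succ no_fwd} => // x c _; apply/set0Pn; exists x; rewrite !inE eqxx.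
move=> z; rewrite inE => zc.
have [b [wz nzc st]] := succ z zc; have := no_fwd z zc.
by case: b wz st => -> st //= _; split=> //; exists (next c z); rewrite ?inE.
Qed.

(** A clash at adjacent vertices x, y is the directed cycle x -> y -> x. *)
Lemma acyclic_clash_free w : ~~ has_dicycle (word_edges w) -> clash_free w.
Proof.
apply: contraR => /forallPn[x /forallPn[y]].
rewrite negb_imply /letter_ok negbK => /and3P[sxy /eqP wx /eqP wy].
have xy : x != y by apply: contraTneq sxy => <-; apply/negP=> sxx; have := s_asym sxx; rewrite sxx.
apply/has_dicycleP; exists [:: x; y] => //.
by rewrite /ucycle /= !inE xy /edge_in !in_word_edges wx wy /= sxy.
Qed.

(** Together with [word_edgesK], this makes [word_edges] and [edge_word] inverse
    bijections between the forests and the fitting acyclic words. *)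
Lemma edge_wordK F : rooted_spanning_forest (fun x y => s x y || s y x) F ->
  word_edges (edge_word F) = F.
Proof.
case/and3P=> /subsetP sub_e /forallP out1 _.
have uniq_out x y z : (x, y) \in F -> (x, z) \in F -> y = z.
  move=> xy xz; apply/eqP; have /card_le1P := out1 x => /(_ y).
  by rewrite inE => /(_ xy z); rewrite !inE xz eq_sym => <-.
apply/setP=> -[x y]; rewrite in_word_edges ffunE.
case: ifP => [/existsP[z /andP[xz sxz]]|/existsPn no_t].
  apply/idP/idP => [sxy|xy]; first by rewrite (step_fun sxy sxz).
  by rewrite (uniq_out _ _ _ xy xz).
case: ifP => [/existsP[z /andP[xz sxz]]|/existsPn no_f].
  apply/idP/idP => [sxy|xy]; first by rewrite (step_fun sxy sxz).
  by rewrite (uniq_out _ _ _ xy xz).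
apply/esym/negP=> xy; have := no_t y; have := no_f y; have := sub_e _ xy.
by rewrite inE /= xy /=; case: (s x y) => //= ->.
Qed.

Lemma word_edgesK w : (edge_word (word_edges w) == w) = fits w.
Proof.
apply/eqP/forallP => [<- x|fit_w].
  rewrite ffunE; case: ifP => [/existsP[y /andP[_ sxy]]|_]; first by apply/existsP; exists y.
  by case: ifP => // /existsP[y /andP[_ sxy]]; apply/existsP; exists y.
apply/ffunP=> x; rewrite ffunE; have := fit_w x; case wx: (w x) => [b|] => [/existsP[y sxy]|_].
  case: ifP => [/existsP[z]|/existsPn no_t].
    rewrite in_word_edges wx => /andP[].
    by case: b {wx sxy} => // szx /s_asym /negP[].
  case: b wx sxy => wx sxy; first by have := no_t y; rewrite in_word_edges wx sxy.
  by case: ifP => // /existsPn/(_ y); rewrite in_word_edges wx sxy.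
by do 2![case: ifP => [/existsP[z]|_]; first by rewrite in_word_edges wx].
Qed.

Lemma word_edges_forest w :
  rooted_spanning_forest (fun x y => s x y || s y x) (word_edges w)
    = ~~ has_dicycle (word_edges w).
Proof.
apply/and3P/idP => [[]//|acyc]; split=> //.
  apply/subsetP=> -[x y]; rewrite in_word_edges inE /=.
  by case: (w x) => // -[] /= ->; rewrite ?orbT.
apply/forallP=> x; apply/card_le1P => y; rewrite inE in_word_edges => xy z.
rewrite !inE /=; case: (w x) xy => // b sxy.
apply/idP/eqP => [sxz|-> //]; exact: step_fun sxz sxy.
Qed.

Lemma roots_word_edges w : fits w -> Defs.roots (word_edges w) = [set x | w x == None].
Proof.
move=> /forallP fit_w; apply/setP=> x; rewrite !inE.
apply/forallP/eqP => [no_out|wx y]; last by rewrite in_word_edges wx.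
have := fit_w x; case wx: (w x) => [b|//] /existsP[y sxy].
by have := no_out y; rewrite in_word_edges wx sxy.
Qed.

(** A root is a vertex labelled [None], so the weight of a forest is a product
    of local weights, one for each letter. *)
Lemma Z_words (R : comPzSemiRingType) (q : R) :
  Z (fun x y => s x y || s y x) q
    = \sum_(w : {ffun T -> option bool} | fits w && ~~ has_dicycle (word_edges w))
        \prod_x (if w x is Some _ then 1 else q).
Proof.
rewrite /Z (reindex_onto word_edges edge_word edge_wordK).
apply: eq_big => [w|w /andP[_]]; first by rewrite word_edges_forest word_edgesK andbC.
rewrite word_edgesK => /roots_word_edges ->.
rewrite -prodr_const big_mkcond; apply: eq_bigr => x _.
by rewrite inE; case: (w x).
Qed.

End Words.

(** * Acyclic words on a path *)

Section PathGraph.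

Definition word_of n (t : n.-tuple (option bool)) : {ffun 'I_n -> option bool} :=
  [ffun i => tnth t i].

Definition succ_path n : rel 'I_n := fun i j => j == i.+1 :> nat.

(** Since only fwd bwd is forbidden, framing the word by fwd on the left and
    bwd on the right encodes the two boundary conditions of a path. *)
Lemma ok_pathP n (t : n.-tuple (option bool)) : (0 < n)%N ->
  reflect [/\ forall i : 'I_n, i = 0 :> nat -> tnth t i != Some false,
              forall i : 'I_n, i.+1 = n -> tnth t i != Some true
            & forall i j : 'I_n, j = i.+1 :> nat -> letter_ok (tnth t i) (tnth t j)]
          (path letter_ok (Some true) (rcons t (Some false))).
Proof.
move=> n_gt0; apply: (iffP (pathP None)); rewrite size_rcons size_tuple.
  move=> ok_t; split=> [i i0|i i_last|i j ij].
  - have := ok_t 0%N isT; rewrite /= nth_rcons size_tuple n_gt0.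
    by rewrite (tnth_nth None) i0 /letter_ok.
  - have := ok_t i.+1; rewrite ltnS ltn_ord /= !nth_rcons size_tuple ltn_ord.
    by rewrite i_last ltnn eqxx (tnth_nth None) /letter_ok andbT => ->.
  - have := ok_t i.+1; rewrite ltnS ltn_ord /= !nth_rcons size_tuple ltn_ord -ij ltn_ord.
    by rewrite !(tnth_nth None); apply.
case=> first_t last_t ok_t [|i] lt_i /=; rewrite !nth_rcons size_tuple.
  by rewrite n_gt0; have := first_t (Ordinal n_gt0) erefl; rewrite (tnth_nth None) /letter_ok.
rewrite ltnS in lt_i; rewrite lt_i.
move: (lt_i); case: (ltngtP i.+1 n) => // [lt_Si|eq_i] _.
  by have := ok_t (Ordinal lt_i) (Ordinal lt_Si) erefl; rewrite !(tnth_nth None).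
by have := last_t (Ordinal lt_i) eq_i; rewrite (tnth_nth None) /letter_ok andbT.
Qed.

(** A monochromatic set closed under stepping would have its largest (or
    smallest) vertex step further out, so the absence of clashes suffices. The
    empty word is excluded because the frame fwd bwd itself clashes. *)
Lemma fits_acyclic_path n (t : n.-tuple (option bool)) : (0 < n)%N ->
  fits (@succ_path n) (word_of t)
    && ~~ has_dicycle (word_edges (@succ_path n) (word_of t))
  = path letter_ok (Some true) (rcons t (Some false)).
Proof.
move=> n_gt0; have asym (i j : 'I_n) : succ_path i j -> ~~ succ_path j i.
  by rewrite /succ_path; lia.
apply/andP/ok_pathP => // [[/forallP fit_t acyc]|[first_t last_t ok_t]].
  have := acyclic_clash_free asym acyc => /'forall_forallP cf.
  split=> [i i0|i i_last|i j ij].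
  - apply/negP=> /eqP ti; have := fit_t i; rewrite ffunE ti => /existsP[j].
    by rewrite /step /succ_path i0.
  - apply/negP=> /eqP ti; have := fit_t i; rewrite ffunE ti => /existsP[j].
    by rewrite /step /succ_path i_last => /eqP jn; have := ltn_ord j; rewrite jn ltnn.
  - by have /implyP := cf i j; rewrite !ffunE; apply; apply/eqP.
split.
  apply/forallP=> i; rewrite ffunE; case ti: (tnth t i) => [[]|//].
    case: (ltnP i.+1 n) => [lt_i|ge_i].
      by apply/existsP; exists (Ordinal lt_i); rewrite /step /succ_path.
    by have := last_t i; rewrite ti eqxx; case/(_ _)/negP=> //; have := ltn_ord i; lia.
  case: i ti => [[|i] lt_i] ti.
    by have := first_t (Ordinal lt_i) erefl; rewrite ti.
  by apply/existsP; exists (Ordinal (ltnW lt_i)); rewrite /step /succ_path /=.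
apply/negP=> /word_edges_dicycle_mono[].
  apply/'forall_'forall_implyP => i j /eqP ij; rewrite !ffunE; exact: ok_t.
move=> b [A [/set0Pn[i0 i0A] closedA]].
case: b closedA => closedA.
  have [i iA max_i] := arg_maxnP (fun i : 'I_n => val i) i0A.
  have [_ [j jA /eqP sij]] := closedA i iA.
  by have := max_i j jA; rewrite /= sij ltnn.
have [i iA min_i] := arg_minnP (fun i : 'I_n => val i) i0A.
have [_ [j jA /eqP sij]] := closedA i iA.
by have := min_i j jA; rewrite /= sij ltnn.
Qed.

End PathGraph.

(** * Acyclic words on a cycle *)

Section CycleGraph.

Definition succ_cycle n : rel 'I_n := fun i j => j == ordS i.

Lemma val_iter_ordS n k (i : 'I_n) : iter k (@ordS n) i = ((i + k) %% n)%N :> nat.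
Proof.
elim: k => [|k IHk] /=; first by rewrite addn0 modn_small.
by rewrite IHk -addn1 modnDml addn1 addnS.
Qed.

Lemma ordS_reach n (i j : 'I_n) : exists k, j = iter k (@ordS n) i.
Proof.
exists (j + (n - i))%N; apply: val_inj; rewrite [RHS]val_iter_ordS /=.
have le_i : (i <= n)%N := ltnW (ltn_ord i).
by rewrite addnCA subnKC // modnDr modn_small.
Qed.

(** The successor map of a cycle is transitive on the vertices, so a set closed
    under it, or under its inverse, is everything. *)
Lemma ordS_closed n b (A : {set 'I_n}) : A != set0 ->
  (forall i, i \in A -> exists2 j, j \in A & step (@succ_cycle n) b i j) ->
  A = [set: 'I_n].
Proof.
move=> /set0Pn[i iA] closedA; apply/setP=> j; rewrite inE.
case: b closedA => closedA.
  have [k ->] := ordS_reach i j.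
  elim: k => //= k IHk; have [l lA] := closedA _ IHk.
  by rewrite /step /succ_cycle => /eqP <-.
have [k eq_i] := ordS_reach j i; elim: k i iA eq_i => [|k IHk] i iA /= eq_i; first by rewrite -eq_i.
have [l lA /eqP eq_l] := closedA _ iA.
by apply: IHk lA _; apply: (@ordS_inj n); rewrite -eq_l.
Qed.

Lemma ok_cycleP n (t : n.-tuple (option bool)) :
  reflect (forall i : 'I_n, letter_ok (tnth t i) (tnth t (ordS i)))
          (cycle letter_ok t).
Proof.
case: n t => [|n] t; first by rewrite tuple0; apply: (iffP idP) => // _ [].
case/tupleP: t => a t; rewrite /cycle /=.
have nthS (i : 'I_n.+1) :
  nth None (rcons t a) i = tnth [tuple of a :: t] (ordS i).
  rewrite nth_rcons size_tuple (tnth_nth None) /=.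
  case: (ltngtP i n) => [lt_i|gt_i|->].
  - by rewrite modn_small.
  - by have := ltn_ord i; lia.
  - by rewrite modnn.
have nth_t (i : 'I_n.+1) :
  nth None (a :: rcons t a) i = tnth [tuple of a :: t] i.
  by rewrite (tnth_nth None) /= -rcons_cons nth_rcons /= size_tuple ltn_ord.
apply: (iffP (pathP None)); rewrite [size (rcons _ _)]size_tuple => ok_t i.
  by have := ok_t i (ltn_ord i); rewrite nthS nth_t.
by move=> lt_i; have := ok_t (Ordinal lt_i); rewrite -nthS -nth_t.
Qed.

(** On two vertices the successor and the predecessor coincide, and a letter is
    no longer determined by its edge: here lies the need for n >= 3. *)
Lemma succ_cycle_asym n : (2 < n)%N ->
  forall i j : 'I_n, succ_cycle i j -> ~~ succ_cycle j i.
Proof.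
move=> n_gt2 i j; rewrite /succ_cycle => /eqP ->; apply/eqP => /(congr1 val) /= /eqP.
have lt_i := ltn_ord i.
case: (ltngtP i.+1 n) lt_i => // [lt_Si|eq_Si] _; last first.
  by rewrite eq_Si modnn modn_small; lia.
rewrite (modn_small lt_Si); case: (ltngtP i.+2 n) lt_Si => // [lt_SSi|eq_SSi] _.
  by rewrite modn_small; lia.
by rewrite eq_SSi modnn; lia.
Qed.

(** By [ordS_closed] a monochromatic closed set forces a constant word, and
    conversely the orbit of the rotation is a directed cycle of each of the two
    constant rootless words. *)
Lemma fits_acyclic_cycle n (t : n.-tuple (option bool)) : (2 < n)%N ->
  fits (@succ_cycle n) (word_of t)
    && ~~ has_dicycle (word_edges (@succ_cycle n) (word_of t))
  = cycle letter_ok t && (t \notin [:: nseq_tuple n (Some true); nseq_tuple n (Some false)]).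
Proof.
move=> n_gt2; have asym := @succ_cycle_asym n n_gt2.
apply/andP/andP=> [[_ acyc]|[/ok_cycleP ok_t not_const]].
  have := acyclic_clash_free asym acyc => /'forall_forallP cf; split.
    apply/ok_cycleP=> i; have /implyP := cf i (ordS i).
    by rewrite !ffunE; apply; rewrite /succ_cycle.
  apply: contra acyc; rewrite !inE => const_t.
  have n_gt0 : (0 < n)%N by lia.
  have [f [b [f_inj t_b f_b]]] : exists (f : 'I_n -> 'I_n) b,
      [/\ injective f, forall i, tnth t i = Some b
        & forall i, step (@succ_cycle n) b i (f i)].
    case/orP: const_t => /eqP ->.
      exists (@ordS n), true; split=> [|i|i]; first exact: ordS_inj.
        by rewrite tnth_nseq.
      exact: eqxx.
    exists (@ord_pred n), false; split=> [|i|i]; first exact: ord_pred_inj.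
      by rewrite tnth_nseq.
    by rewrite /step /succ_cycle ord_predK.
  apply/has_dicycleP; exists (orbit f (Ordinal n_gt0)).
    by apply: contraTneq (in_orbit f (Ordinal n_gt0)) => ->.
  rewrite /ucycle orbit_uniq andbT.
  apply: sub_cycle (cycle_orbit f_inj _) => i j /= /eqP <-.
  by rewrite /edge_in in_word_edges ffunE t_b.
split.
  apply/forallP=> i; rewrite ffunE; case: (tnth t i) => [[]|//]; apply/existsP.
    by exists (ordS i); apply: eqxx.
  by exists (ord_pred i); rewrite /step /succ_cycle ord_predK.
apply: contra not_const => /word_edges_dicycle_mono[].
  by apply/'forall_'forall_implyP => i j /eqP ->; rewrite !ffunE; apply: ok_t.
move=> b [A [A_neq0 closedA]].
have AT : A = [set: 'I_n].
  by apply: (@ordS_closed _ b) => // i /closedA[].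
have -> : t = nseq_tuple n (Some b).
  apply: eq_from_tnth => i; rewrite tnth_nseq.
  by have [] := closedA i; rewrite ?AT ?inE // ffunE.
by case: b {closedA}; rewrite !inE eqxx ?orbT.
Qed.

End CycleGraph.

(** * Counting words by transfer *)

Section Counting.

Variables (R : comNzRingType) (q : R).

Notation fwd := (Some true).
Notation bwd := (Some false).

Definition weight (a : option bool) : R := if a is Some _ then 1 else q.

Definition walk_sum n (a b : option bool) : R :=
  \sum_(t : n.-tuple (option bool) | path letter_ok a (rcons t b))
     \prod_(c <- t) weight c.

Lemma sum_tuple_cons (S : finType) n (F : n.+1.-tuple S -> R) :
  \sum_t F t = \sum_c \sum_(t : n.-tuple S) F [tuple of c :: t].
Proof.
rewrite pair_big /=.
rewrite (reindex (fun p : S * n.-tuple S => [tuple of p.1 :: p.2])) //=.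
exists (fun t => (thead t, [tuple of behead t])) => [[c t] _|t _] /=.
  by rewrite theadE; congr (_, _); apply: val_inj.
by rewrite -tuple_eta.
Qed.

Lemma sum_letters (F : option bool -> R) :
  \sum_c F c = F bwd + (F None + F fwd).
Proof.
rewrite (bigD1 bwd) // (bigD1 None) // (bigD1 fwd) //= big1 ?addr0 //.
by case=> [[]|].
Qed.

Lemma walk_sum0 a b : walk_sum 0 a b = (letter_ok a b)%:R.
Proof.
rewrite /walk_sum big_mkcond (bigD1 [tuple]) //= [X in _ + X]big1 => [|t];
  last by rewrite (tuple0 t).
by rewrite andbT big_nil addr0; case: ifP.
Qed.

Lemma walk_sumS n a b :
  walk_sum n.+1 a b = \sum_c (letter_ok a c)%:R * weight c * walk_sum n c b.
Proof.
rewrite /walk_sum big_mkcond sum_tuple_cons; apply: eq_bigr => c _.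
rewrite big_distrr [RHS]big_mkcond; apply: eq_bigr => t _ /=.
by case: (letter_ok a c) => /=; case: ifP; rewrite ?big_cons ?mul1r ?mul0r ?mulr0.
Qed.

(** Only [fwd] constrains the letter after it, and only [bwd] the letter before
    it; so as a left frame [None] acts like [bwd], and as a right frame like
    [fwd]. *)
Lemma walk_sum_None n b : walk_sum n None b = walk_sum n bwd b.
Proof. by apply: eq_bigl => t; case: (tval t). Qed.

Lemma walk_sum_to_None n a : walk_sum n a None = walk_sum n a fwd.
Proof. by apply: eq_bigl => t; rewrite !rcons_path /letter_ok !andbF. Qed.

Lemma walk_sum_fwd n b :
  walk_sum n.+1 fwd b = q * walk_sum n bwd b + walk_sum n fwd b.
Proof. by rewrite walk_sumS sum_letters walk_sum_None /=; ring. Qed.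

Lemma walk_sum_bwd n b :
  walk_sum n.+1 bwd b = walk_sum n bwd b + walk_sum n.+1 fwd b.
Proof. by rewrite walk_sum_fwd walk_sumS sum_letters walk_sum_None /=; ring. Qed.

(** The diagonal terms of the trace, expressed by the frames ending in [bwd].
    For the first, read words backwards and exchange the two directions. For
    the second, write a word framed by roots as u fwd^j with j maximal: then
    fwd^j None u is a path word with one root more, and every path word arises
    once, being fwd^j up to its first root. The proof is an induction on the
    recurrences instead. *)
Lemma walk_sum_symmetry n :
  walk_sum n fwd fwd = walk_sum n bwd bwd /\
  q * walk_sum n bwd fwd = walk_sum n.+1 fwd bwd.
Proof.
elim: n => [|n [IHff IHbf]]; first by rewrite walk_sum_fwd !walk_sum0 /=; split; ring.
have ff : walk_sum n.+1 fwd fwd = walk_sum n.+1 bwd bwd.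
  by rewrite walk_sum_fwd IHff IHbf walk_sum_bwd addrC.
by split=> //; rewrite walk_sum_bwd ff mulrDr IHbf addrC -walk_sum_fwd.
Qed.

(** The letter at the cut frames the rest of the cyclic word on both sides,
    hence the trace. *)
Lemma cycle_sum n :
  \sum_(t : n.+1.-tuple (option bool) | cycle letter_ok t) \prod_(c <- t) weight c
    = walk_sum n.+1 fwd bwd + 2 * walk_sum n bwd bwd.
Proof.
have [ff bf] := walk_sum_symmetry n.
have -> : \sum_(t : n.+1.-tuple (option bool) | cycle letter_ok t)
    \prod_(c <- t) weight c = \sum_a weight a * walk_sum n a a.
  rewrite big_mkcond sum_tuple_cons; apply: eq_bigr => a _.
  rewrite big_distrr [RHS]big_mkcond; apply: eq_bigr => t _ /=.
  by case: ifP; rewrite ?big_cons.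
by rewrite sum_letters walk_sum_None walk_sum_to_None /= bf ff; ring.
Qed.

(** On the right the term k = n is zero; it is kept so that the range matches
    that of the sum to which this one is added. *)
Lemma sum_bin_even_split n :
  \sum_(k < n.+1) 'C(n + k, 2 * k)%:R * q ^+ k
    = 1 + \sum_(k < n.+1) 'C(n.+1 + k, (2 * k).+2)%:R * q ^+ k.+1.
Proof.
rewrite big_ord_recl [in RHS]big_ord_recr /= bin0 mulr1; congr (_ + _).
rewrite [X in _ = _ + X](_ : _ = 0) ?addr0; last by rewrite bin_small ?mul0r //; lia.
apply: eq_bigr => k _; rewrite /bump /=.
by congr ('C(_, _)%:R * _); lia.
Qed.

(** Both recurrences are instances of Pascal's rule on coefficients:
    C(n+1+k, 2k+1) = C(n+k, 2k) + C(n+k, 2k+1) for the first, and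
    C(n+k+2, 2k+2) = C(n+k+1, 2k+2) + C(n+k+1, 2k+1) for the second. *)
Lemma walk_sum_closed n :
  walk_sum n bwd bwd = \sum_(k < n.+1) 'C(n + k, 2 * k)%:R * q ^+ k /\
  walk_sum n fwd bwd = \sum_(k < n) 'C(n + k, (2 * k).+1)%:R * q ^+ k.+1.
Proof.
elim: n => [|n [IHb IHf]].
  by rewrite !walk_sum0 big_ord_recl !big_ord0 /= bin0 mulr1 addr0.
have f_closed : walk_sum n.+1 fwd bwd
    = \sum_(k < n.+1) 'C(n.+1 + k, (2 * k).+1)%:R * q ^+ k.+1.
  (* The extra term of index n is zero and aligns the ranges. *)
  rewrite walk_sum_fwd; have -> : walk_sum n fwd bwd
      = \sum_(k < n.+1) 'C(n + k, (2 * k).+1)%:R * q ^+ k.+1.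
    by rewrite IHf big_ord_recr /= bin_small ?mul0r ?addr0 //; lia.
  rewrite {}IHb {IHf} mulr_sumr -big_split; apply: eq_bigr => k _ /=.
  by rewrite addSn binS natrD exprS; ring.
split=> //; rewrite walk_sum_bwd f_closed IHb.
rewrite sum_bin_even_split [RHS]big_ord_recl /= bin0 mulr1 -addrA -big_split; congr (_ + _).
apply: eq_bigr => k _; rewrite /bump /= -mulrDl -natrD -binS.
by congr ('C(_, _)%:R * _); lia.
Qed.

Lemma Z_tuples n (s : rel 'I_n)
    (s_fun : forall x y z, s x y -> s x z -> y = z)
    (s_inj : forall x y z, s x z -> s y z -> x = y)
    (s_asym : forall x y, s x y -> ~~ s y x) :
  Z (fun i j => s i j || s j i) q
    = \sum_(t : n.-tuple (option bool) |
              fits s (word_of t) && ~~ has_dicycle (word_edges s (word_of t)))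
        \prod_(c <- t) weight c.
Proof.
rewrite (Z_words s_fun s_inj s_asym) (reindex (@word_of n)) /=.
  apply: eq_bigr => t _; rewrite big_tuple; apply: eq_bigr => i _.
  by rewrite ffunE.
exists (fun w : {ffun 'I_n -> option bool} => [tuple w i | i < n]) => [t _|w _].
  by apply: eq_from_tnth => i; rewrite tnth_mktuple ffunE.
by apply/ffunP=> i; rewrite ffunE tnth_mktuple.
Qed.

(** * Partition functions of paths and cycles *)

Lemma Z_path n : (0 < n)%N -> Z (@path_graph n) q = walk_sum n fwd bwd.
Proof.
move=> n_gt0; rewrite (Z_tuples (s := @succ_path n)).
- by apply: eq_bigl => t; rewrite fits_acyclic_path.
- by move=> x y z /eqP xy /eqP xz; apply: val_inj; rewrite /= xy xz.
- by move=> x y z /eqP zx /eqP; rewrite zx => -[] /val_inj.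
- by move=> x y; rewrite /succ_path; lia.
Qed.

Lemma Z_cycle n : (2 < n.+1)%N ->
  Z (@cycle_graph n.+1) q = walk_sum n.+1 fwd bwd + 2 * walk_sum n bwd bwd - 2.
Proof.
move=> n_gt2; rewrite (Z_tuples (s := @succ_cycle n.+1)).
- rewrite (eq_bigl _ _ (fun t => fits_acyclic_cycle t n_gt2)) -cycle_sum.
  have const b : \prod_(c <- nseq_tuple n.+1 (Some b)) weight c = 1.
    by rewrite big_tuple big1 // => i _; rewrite tnth_nseq.
  have const_ok b : cycle letter_ok (nseq_tuple n.+1 (Some b)).
    by apply/ok_cycleP=> i; rewrite !tnth_nseq; case: b.
  (* Each constant word has weight 1, as it has no root. *)
  rewrite [in RHS](bigD1 (nseq_tuple n.+1 fwd)) ?const_ok //=.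
  rewrite [in RHS](bigD1 (nseq_tuple n.+1 bwd)) ?const_ok //= !const.
  rewrite [X in _ + (_ + X) - _](eq_bigl (fun t : n.+1.-tuple _ => cycle letter_ok t
     && (t \notin [:: nseq_tuple n.+1 fwd; nseq_tuple n.+1 bwd]))); first by ring.
  by move=> t; rewrite !inE negb_or andbA.
- by move=> x y z /eqP -> /eqP ->.
- by move=> x y z /eqP -> /eqP /ordS_inj.
- exact: succ_cycle_asym.
Qed.

End Counting.

Theorem corollary1 (R : realFieldType) (n : nat) (q : R)
  (hn : (3 <= n)%N) (hq : 0 < q) :
  Z (@cycle_graph n) q
    = Z (@path_graph n) q
      + 2 / q * (Z (@path_graph n) q - Z (@path_graph (n - 1)) q) - 2
  /\
  Z (@path_graph n) q
      + 2 / q * (Z (@path_graph n) q - Z (@path_graph (n - 1)) q) - 2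
    = \sum_(1 <= k < n.+1)
        ('C(n + k, 2 * k) + 'C(n + k - 1, 2 * k))%:R * q ^+ k.
Proof.
have q_neq0 : q != 0 by rewrite gt_eqF.
case: n hn => // n hn.
have -> : Z (@path_graph n.+1) q + 2 / q * (Z (@path_graph n.+1) q
      - Z (@path_graph (n.+1 - 1)) q) - 2
    = walk_sum q n.+1 (Some true) (Some false)
      + 2 * walk_sum q n (Some false) (Some false) - 2.
  rewrite subn1 !Z_path //; last by lia.
  by rewrite walk_sum_fwd; field.
split; first exact: Z_cycle.
have [-> _] := walk_sum_closed q n; have [_ ->] := walk_sum_closed q n.+1.
rewrite sum_bin_even_split mulrDr mulr1 addrA addrAC addrK.
rewrite big_add1 big_mkord mulr_sumr -big_split; apply: eq_bigr => k _ /=.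
have -> : (n.+1 + k.+1 = (n.+1 + k).+1)%N by lia.
have -> : (2 * k.+1 = (2 * k).+2)%N by lia.
by rewrite subn1 /= binS !natrD; ring.
Qed.
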